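(* Let $X_1,\dots,X_n$ be bounded variables and let $B_1,\dots,B_n$ be real numbers with $\sup X_i-\inf X_i\le B_i$ for each $i$. Put $\gamma_n=\sum_{i=1}^n B_i^2$ and suppose $\gamma_n>0$. Suppose that for all bounded nonnegative functions $f_1,\dots,f_n$, $$\overline{E}\Big[\prod_{i=1}^n f_i(X_i)\Big]\le\prod_{i=1}^n\overline{E}[f_i(X_i)].$$ Then for every $\epsilon>0$, $$\overline{P}\Big(\sum_{i=1}^n (X_i-\overline{E}[X_i])\ge\epsilon\Big)\le e^{-2\epsilon^2/\gamma_n} \quad\text{and}\quad \overline{P}\Big(\sum_{i=1}^n (X_i-\underline{E}[X_i])\le-\epsilon\Big)\le e^{-2\epsilon^2/\gamma_n}.$$
   Context: Variables are real-valued functions on a possibility space $\Omega$; an event is identified with its indicator function. An expectation functional $E$ maps bounded variables to real numbers and satisfies: (1) if $\alpha\le X\le\beta$ pointwise, with $\alpha,\beta$ real numbers, then $\alpha\le E[X]\le\beta$; (2) $E[X+Y]=E[X]+E[Y]$. It induces a finitely additive probability measure by $P(A)=E[A]$ for events $A$ (countable additivity is not assumed). A nonempty set $\mathcal{K}$ of expectation functionals is fixed. Lower and upper expectations are $\underline{E}[X]=\inf_{E\in\mathcal{K}}E[X]$ and $\overline{E}[X]=\sup_{E\in\mathcal{K}}E[X]$; lower and upper probabilities are $\underline{P}(A)=\underline{E}[A]$ and $\overline{P}(A)=\overline{E}[A]$. *)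

(* Defs.v *)
From HB Require Import structures.
From mathcomp Require Import all_boot all_order all_algebra.
From mathcomp Require Import all_classical all_reals all_analysis.

Set Implicit Arguments.
Unset Strict Implicit.
Unset Printing Implicit Defensive.

Import Order.TTheory GRing.Theory Num.Theory.
Import numFieldNormedType.Exports.

Local Open Scope classical_set_scope.
Local Open Scope ring_scope.

(* A functional is a total function on [Omega -> R], but it is constrained only
   on bounded variables; its values on unbounded variables are junk. In
   [expectation_bounds], boundedness of [X] is implied by the hypothesis. *)
Record expectation_functional (R : realType) (Omega : Type) :=
    ExpectationFunctional {
  expectation_fun :> (Omega -> R) -> R ;
  expectation_bounds : forall (X : Omega -> R) (a b : R),
    (forall w, a <= X w <= b) -> a <= expectation_fun X <= b ;
  expectation_add : forall X Y : Omega -> R,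
    bounded_fun X -> bounded_fun Y ->
    expectation_fun (X \+ Y) = expectation_fun X + expectation_fun Y }.

(* [inf] and [sup] are the real-valued ones, which are 0 on sets that are empty
   or unbounded on the relevant side. For nonempty [K] and bounded [X] the set
   [E X | E in K] is nonempty and bounded, by [expectation_bounds]. *)
Definition lower_expectation (R : realType) (Omega : Type)
    (K : set (expectation_functional R Omega)) (X : Omega -> R) : R :=
  inf [set E X | E in K].

Definition upper_expectation (R : realType) (Omega : Type)
    (K : set (expectation_functional R Omega)) (X : Omega -> R) : R :=
  sup [set E X | E in K].

Definition upper_probability (R : realType) (Omega : Type)
    (K : set (expectation_functional R Omega)) (A : set Omega) : R :=
  upper_expectation K \1_A.

(* Main.v *)
Require Import Defs.
From HB Require Import structures.
From mathcomp Require Import all_boot all_order all_algebra.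
From mathcomp Require Import all_classical all_reals all_analysis.
From mathcomp Require Import ring lra.

(** This is Hoeffding's inequality; the classical proof goes through because it
    never needs more than monotonicity, finite linearity and the assumed product
    bound.

    Fix [s >= 0] and write [mu i] for the upper expectation of [X i]. By Markov's
    argument, the indicator of the event that [\sum_i (X i - mu i) >= eps] is at
    most [expR (- s eps) * \prod_i expR (s (X i - mu i))]. The factors are bounded
    nonnegative functions of the [X i], so the hypothesis on products reduces the
    claim to bounding each upper expectation of [expR (s (X i - mu i))]. For [E]
    in [K], [E (X i) <= mu i], so [X i] may be centred at [E (X i)] instead, and
    Hoeffding's lemma ([expectation_hoeffding]) bounds the result by
    [expR (s^2 (B i)^2 / 8)], uniformly in [E]. The choice [s = 4 eps / gamma]
    optimises the exponent [- s eps + s^2 gamma / 8].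

    Hoeffding's lemma itself combines the bound of the exponential by its chord on
    the range of the variable, which reduces it to a two-point distribution, with
    a calculus estimate for that distribution ([bernoulli_mgf_le]). Taking the
    expectation of the chord needs real homogeneity of [E]; this is not an axiom,
    but an additive function that is bounded on an interval is linear
    ([additive_bounded_linear]).

    The lower tail is the upper tail of the variables [- X i], whose upper
    expectations are the opposites of the lower expectations of the [X i]. *)

Set Implicit Arguments.
Unset Strict Implicit.
Unset Printing Implicit Defensive.

Import Order.TTheory GRing.Theory Num.Theory.
Import numFieldNormedType.Exports.

Local Open Scope classical_set_scope.
Local Open Scope ring_scope.

(** * Bounded variables and expectation functionals *)

Lemma bounded_fun_itv (R : realType) (T : Type) (X : T -> R) (a b : R) :
  (forall w, a <= X w <= b) -> bounded_fun X.
Proof.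
move=> Xab; exists (Num.max `|a| `|b|); split; first exact: num_real.
move=> M /ltW abM w _ /=; apply: le_trans abM.
have /andP[aX Xb] := Xab w.
have aM := ler_norm (- a); have bM := ler_norm b; rewrite normrN in aM.
rewrite ler_norml lerNl !le_max (le_trans Xb bM) orbT andbT.
by rewrite (le_trans _ aM)// lerN2.
Qed.

Lemma bounded_fun_norm (R : realType) (T : Type) (X : T -> R) :
  bounded_fun X -> exists M, forall w, `|X w| <= M.
Proof.
move=> [M [_ XM]]; exists (M + 1) => w.
by apply: (XM (M + 1)) => //; rewrite ltrDl.
Qed.

Section expectation.
Variables (R : realType) (Omega : Type) (E : expectation_functional R Omega).
Implicit Types (X Y : Omega -> R) (a b c : R).

Lemma expectation_cst c : E (fun=> c) = c.
Proof.
by apply/eqP; rewrite eq_le andbC; apply: expectation_bounds => w; rewrite lexx.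
Qed.

Lemma expectationN X : bounded_fun X -> E (fun w => - X w) = - E X.
Proof.
move=> bX; have [M XM] := bounded_fun_norm bX.
have bN : bounded_fun (fun w => - X w).
  by apply: (@bounded_fun_itv _ _ _ (- M) M) => w; rewrite -ler_norml normrN.
apply/eqP; rewrite -addr_eq0 addrC -expectation_add//.
suff -> : X \+ (fun w => - X w) = fun=> 0 by rewrite expectation_cst.
by apply/funext => w /=; rewrite subrr.
Qed.

Lemma expectation_le X Y : bounded_fun X -> bounded_fun Y ->
  (forall w, X w <= Y w) -> E X <= E Y.
Proof.
move=> bX bY XY; have [M XM] := bounded_fun_norm bX.
have [N YN] := bounded_fun_norm bY.
have D0 w : 0 <= Y w - X w <= N + M.
  by rewrite subr_ge0 XY/= lerD ?(ler_normlW (YN w))// (ler_normlW _)// normrN.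
have -> : Y = X \+ (fun w => Y w - X w).
  by apply/funext => w /=; rewrite addrC subrK.
rewrite expectation_add//; last exact: bounded_fun_itv D0.
by rewrite lerDl; have /andP[] := expectation_bounds E D0.
Qed.

End expectation.

(** [h x = g x - x * g 1] is additive and vanishes on the integers, so it is
    1-periodic, and hence bounded on the whole line; a bounded additive function
    is zero, since [h (x *+ n) = h x *+ n]. *)
Lemma additive_bounded_linear (R : realType) (g : R -> R) (M : R) :
  (forall x y, g (x + y) = g x + g y) ->
  (forall x, 0 <= x <= 1 -> `|g x| <= M) ->
  forall x, g x = x * g 1.
Proof.
move=> gD gM; pose h x := g x - x * g 1.
have hD x y : h (x + y) = h x + h y by rewrite /h gD; ring.
have h0 : h 0 = 0 by have := hD 0 0; rewrite addr0 => H; lra.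
have hn n x : h (x *+ n) = h x *+ n.
  by elim: n => [|n IH]; rewrite ?mulr0n// !mulrS hD IH.
have hN x : h (- x) = - h x by have := hD x (- x); rewrite subrr h0 => H; lra.
have h1 : h 1 = 0 by rewrite /h mul1r subrr.
have hz (z : int) : h z%:~R = 0.
  by case: z => n; rewrite ?NegzE ?mulrNz ?hN -?pmulrn hn h1 mul0rn ?oppr0.
have hM x : `|h x| <= M + M.
  have /andP[fx xf] := floor_itv x; set k := Num.floor x in fx xf.
  rewrite -(subrK k%:~R x) hD hz addr0 /h.
  rewrite intrD in xf.
  set y := x - _; have y01 : 0 <= y <= 1 by rewrite /y; lra.
  have g1 : `|g 1| <= M by apply: gM; lra.
  rewrite (le_trans (ler_normB _ _))// lerD ?gM// normrM.
  by rewrite (le_trans _ g1)// ler_piMl// ger0_norm; lra.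
(* If [h x] were not 0, then [n * |h x|] would exceed the bound for this [n]. *)
move=> x; apply/eqP; rewrite -subr_eq0 -/(h x) -normr_le0 leNgt; apply/negP => hx.
pose n := (Num.truncn ((M + M) / `|h x|)).+1.
have := hM (x *+ n); rewrite hn normrMn leNgt => /negP; apply.
by rewrite -mulr_natr mulrC -ltr_pdivrMr// truncnS_gt.
Qed.

(** Additivity gives this for rational [c] only; the bounds on [E] extend it to
    the reals. *)
Lemma expectationZ (R : realType) (Omega : Type)
    (E : expectation_functional R Omega) (X : Omega -> R) (c : R) :
  bounded_fun X -> E (fun w => c * X w) = c * E X.
Proof.
move=> bX; have [M XM] := bounded_fun_norm bX.
have cXM (x : R) w : - (`|x| * M) <= x * X w <= `|x| * M.
  by rewrite -ler_norml normrM ler_wpM2l.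
have bcX (x : R) : bounded_fun (fun w => x * X w) := bounded_fun_itv (cXM x).
rewrite (@additive_bounded_linear _ (fun x => E (fun w => x * X w)) M).
- by congr (_ * E _); apply/funext => w; rewrite mul1r.
- move=> x y; rewrite -expectation_add//; congr (expectation_fun E _).
  by apply/funext => w /=; rewrite mulrDl.
- move=> x /andP[x0 x1]; rewrite ler_norml; apply: expectation_bounds => w.
  rewrite -ler_norml normrM ger0_norm// (le_trans _ (XM w))//.
  by rewrite ler_piMl.
Qed.

(** * Upper and lower expectations *)

Section upper.
Variables (R : realType) (Omega : Type).
Variables (K : set (expectation_functional R Omega)).
Implicit Types (X Y : Omega -> R) (c : R).

Lemma upper_expectation_le X c : K !=set0 ->
  (forall E, K E -> E X <= c) -> upper_expectation K X <= c.
Proof.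
move=> [E0 KE0] Xc; apply: ge_sup; first by exists (E0 X), E0.
by move=> _ [E KE <-]; exact: Xc.
Qed.

Lemma le_upper_expectation X (E : expectation_functional R Omega) :
  bounded_fun X -> K E -> E X <= upper_expectation K X.
Proof.
move=> bX KE; apply: ub_le_sup; last by exists E.
have [M XM] := bounded_fun_norm bX.
exists M => _ [F _ <-].
have /(expectation_bounds F)/andP[] // : forall w, - M <= X w <= M.
by move=> w; rewrite -ler_norml.
Qed.

Lemma upper_expectationN X : bounded_fun X ->
  upper_expectation K (fun w => - X w) = - lower_expectation K X.
Proof.
move=> bX; rewrite /lower_expectation /inf opprK /upper_expectation; congr sup.
apply/seteqP; split => [_ [E KE <-]|_ [_ [E KE <-] <-]].
  by exists (E X); [exists E|rewrite expectationN].
by exists E => //; rewrite expectationN.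
Qed.

End upper.

(** * Hoeffding's lemma *)

Lemma derive_ge0_ge_at0 (R : realType) (f df : R -> R) :
  (forall x : R, is_derive x 1 f (df x)) -> (forall x, 0 < x -> 0 <= df x) ->
  forall x, 0 <= x -> f 0 <= f x.
Proof.
move=> fdf df0 x x0.
have fD y : derivable f y 1 by have [] := fdf y.
apply: (@ger0_derive1_ndecry _ f 0) => //.
- move=> y; rewrite in_itv/= andbT => y0; rewrite derive1E.
  by have [_ ->] := fdf y; exact: df0.
- by apply: derivable_within_continuous => y _.
Qed.

(** The left side is the moment generating function at [h] of a centred Bernoulli
    variable of parameter [p]. With [q x = 1 - p + p e^x], the claim is that
    [expR (- x^2 / 8 - x p) * q x] is at most its value 1 at 0. Its derivative is
    minus itself times [G x = x / 4 + p - p e^x / q x], and [G 0 = 0] while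
    [G' x = 1 / 4 - (1 - p) p e^x / (q x)^2] is nonnegative by the inequality of
    arithmetic and geometric means. *)
Lemma bernoulli_mgf_le (R : realType) (p h : R) : 0 <= p <= 1 -> 0 <= h ->
  (1 - p) * expR (- (h * p)) + p * expR (h * (1 - p)) <= expR (h ^+ 2 / 8).
Proof.
move=> p01 h0.
pose q x := 1 - p + p * expR x.
have q_gt0 x : 0 < q x.
  rewrite /q; have e0 := expR_gt0 x; have [->|pn0] := eqVneq p 0; first lra.
  have : 0 < p * expR x by rewrite mulr_gt0// lt0r pn0; lra.
  lra.
have dq (x : R) : is_derive x 1 q (p * expR x).
  by apply: is_derive_eq; rewrite /GRing.scale/=; ring.
(* This form of [G] has the variable in the denominator only. *)
pose G x := x / 4 + p - 1 + (1 - p) * (q x)^-1.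
have G_ge0 x : 0 <= x -> 0 <= G x.
  have G0 : G 0 = 0 by rewrite /G /q expR0; field; lra.
  move=> x0; rewrite -G0; move: x x0.
  apply: (@derive_ge0_ge_at0 _ _
    (fun x => 4^-1 - (1 - p) * (p * expR x) / q x ^+ 2)).
    move=> y; have qn0 : q y != 0 by rewrite gt_eqF.
    have ? := is_deriveV qn0 (dq y).
    by apply: is_derive_eq; rewrite /GRing.scale/=; field.
  move=> y _; rewrite subr_ge0 ler_pdivrMr ?exprn_gt0//.
  have := sqr_ge0 (1 - p - p * expR y); rewrite /q; nra.
pose F x := - (expR (- (x ^+ 2 / 8) - x * p) * q x).
have : F 0 <= F h.
  apply: (@derive_ge0_ge_at0 _ _
    (fun x => expR (- (x ^+ 2 / 8) - x * p) * q x * G x)) => //.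
    move=> y; have qn0 : q y != 0 by rewrite gt_eqF.
    apply: is_derive_eq; rewrite /GRing.scale/= /G.
    rewrite [p * expR y](_ : _ = q y - (1 - p)); last by rewrite /q; ring.
    by field.
  by move=> y y0; rewrite !mulr_ge0 ?expR_ge0 ?(ltW (q_gt0 y)) ?G_ge0 ?ltW.
have -> : F 0 = -1 by rewrite /F /q [- (_ / _) - _](_ : _ = 0) ?expR0; ring.
rewrite lerN2 => H.
have -> : (1 - p) * expR (- (h * p)) + p * expR (h * (1 - p)) =
  expR (h ^+ 2 / 8) * (expR (- (h ^+ 2 / 8) - h * p) * q h).
  rewrite mulrA -expRD [X in expR X * q h](_ : _ = - (h * p)); last by ring.
  rewrite /q [h * (1 - p)](_ : _ = - (h * p) + h); last by ring.
  by rewrite expRD; ring.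
by rewrite ler_piMr// expR_ge0.
Qed.

(** The graph of [expR] lies above its tangent at the intermediate point; averaging
    the tangent bounds at [u] and [v] cancels the linear terms. *)
Lemma expR_chord (R : realType) (u v l : R) : 0 <= l <= 1 ->
  expR ((1 - l) * u + l * v) <= (1 - l) * expR u + l * expR v.
Proof.
move=> /andP[l0 l1].
have tangent t x : expR t * (1 + (x - t)) <= expR x.
  rewrite -[X in _ <= expR X](subrK t) expRD mulrC.
  by rewrite ler_wpM2r ?expR_ge0// expR_ge1Dx.
set t := _ + _.
rewrite [leLHS](_ : _ = (1 - l) * (expR t * (1 + (u - t))) +
                        l * (expR t * (1 + (v - t)))).
  by apply: lerD; apply: ler_wpM2l; rewrite ?subr_ge0//; exact: tangent.
by rewrite /t; ring.
Qed.

(** [l = (X w - a) / B] and [p = (E X - a) / B] are the positions of [X w] and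
    [E X] in the interval. The chord bound on [expR (s (X w - E X))] is affine in
    [X w], so its expectation is its value at [l = p], which is the Bernoulli
    moment generating function at [s * B]. *)
Lemma expectation_hoeffding (R : realType) (Omega : Type)
    (E : expectation_functional R Omega) (X : Omega -> R) (a B s : R) :
  (forall w, a <= X w <= a + B) -> 0 <= s ->
  E (fun w => expR (s * (X w - E X))) <= expR (s ^+ 2 * B ^+ 2 / 8).
Proof.
move=> XaB s0; have /andP[aE EB] := expectation_bounds E XaB.
have [B0|] := ltP 0 B; last first.
  (* Only [B = 0] is left, as [a <= E X <= a + B]; then [X] is constant. *)
  move=> B0; have {}B0 : B = 0 by lra.
  have XE w : X w - E X = 0 by have := XaB w; lra.
  under eq_fun do rewrite XE mulr0 expR0.
  by rewrite expectation_cst B0 expr0n/= mulr0 mul0r expR0.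
have bX := bounded_fun_itv XaB.
pose p := (E X - a) / B; pose h := s * B.
have p01 : 0 <= p <= 1 by rewrite /p ler_pdivrMr// divr_ge0; lra.
rewrite -exprMn -/h (le_trans _ (bernoulli_mgf_le p01 _))//; last first.
  by rewrite mulr_ge0// ltW.
(* The chord, as an affine function of [X w], is [c * X w + d]. *)
pose c := (expR (h * (1 - p)) - expR (- (h * p))) / B.
pose d := expR (- (h * p)) - a * c.
have -> : (1 - p) * expR (- (h * p)) + p * expR (h * (1 - p)) =
    E ((fun w => c * X w) \+ (fun=> d)).
  rewrite expectation_add.
  - rewrite expectationZ// expectation_cst /d /c /p; field; lra.
  - have [M XM] := bounded_fun_norm bX.
    apply: (@bounded_fun_itv _ _ _ (- (`|c| * M)) (`|c| * M)) => w.
    by rewrite -ler_norml normrM ler_wpM2l.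
  - by apply: (@bounded_fun_itv _ _ _ d d) => w; rewrite lexx.
apply: expectation_le => //.
- apply: (@bounded_fun_itv _ _ _ 0 (expR (h * (1 - p)))) => w.
  rewrite expR_ge0 ler_expR /h /p /=.
  have -> : s * B * (1 - (E X - a) / B) = s * (a + B - E X) by field; lra.
  by have := XaB w => /andP[_ ?]; rewrite ler_wpM2l// lerB.
- have -> : (fun w => c * X w) \+ (fun=> d) = fun w => c * X w + d by [].
  apply: (@bounded_fun_itv _ _ _ (expR (- (h * p))) (expR (h * (1 - p)))) => w.
  have /andP[aX XB] := XaB w.
  have c0 : 0 <= c.
    apply: divr_ge0; last exact: ltW.
    rewrite subr_ge0 ler_expR.
    have : 0 <= h by rewrite /h mulr_ge0// ltW.
    lra.
  have -> : expR (h * (1 - p)) = c * (a + B) + d by rewrite /d /c; field; lra.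
  have -> : expR (- (h * p)) = c * a + d by rewrite /d /c; field; lra.
  by rewrite !lerD2r !ler_wpM2l.
move=> w /=; have /andP[aX XB] := XaB w.
pose l := (X w - a) / B.
have l01 : 0 <= l <= 1 by rewrite /l ler_pdivrMr// divr_ge0; lra.
have := expR_chord (- (h * p)) (h * (1 - p)) l01.
have -> : (1 - l) * - (h * p) + l * (h * (1 - p)) = s * (X w - E X).
  by rewrite /l /h /p; field; lra.
move/le_trans; apply; rewrite le_eqVlt; apply/orP; left; apply/eqP.
by rewrite /d /c /l; field; lra.
Qed.

(** * The tail bounds *)

(** The range hypothesis only asks for some interval of length [B i] around [X i],
    a form that is invariant under passing from [X i] to [- X i]. *)
Lemma hoeffding_upper_tail (R : realType) (Omega : Type)
    (K : set (expectation_functional R Omega)) (K_nonempty : K !=set0)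
    (n : nat) (X : 'I_n -> Omega -> R) (a B : 'I_n -> R)
    (X_itv : forall i w, a i <= X i w <= a i + B i)
    (gamma_gt0 : 0 < \sum_(i < n) B i ^+ 2)
    (X_prod : forall f : 'I_n -> R -> R,
      (forall i, bounded_fun (f i)) ->
      (forall i x, 0 <= f i x) ->
      upper_expectation K (fun w => \prod_(i < n) f i (X i w))
        <= \prod_(i < n) upper_expectation K (fun w => f i (X i w)))
    (eps : R) (eps_gt0 : 0 < eps) :
  upper_probability K
    [set w | \sum_(i < n) (X i w - upper_expectation K (X i)) >= eps]
    <= expR (- 2 * eps ^+ 2 / \sum_(i < n) B i ^+ 2).
Proof.
set gamma := \sum_(i < n) _ in gamma_gt0 *.
set A := [set w | _].
pose mu i := upper_expectation K (X i).
pose s := 4 * eps / gamma.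
have s_ge0 : 0 <= s by rewrite /s divr_ge0 ?mulr_ge0// ltW.
(* The truncation makes [f i] bounded on the whole line and does not change
   [f i (X i)]. *)
pose f i x := expR (s * (Num.min x (a i + B i) - mu i)).
have f_ge0 i x : 0 <= f i x by exact: expR_ge0.
have f_le i x : f i x <= expR (s * (a i + B i - mu i)).
  by rewrite ler_expR ler_wpM2l// lerB// ge_min lexx orbT.
have fX i w : f i (X i w) = expR (s * (X i w - mu i)).
  by rewrite /f min_l//; have /andP[] := X_itv i w.
have bfX i : bounded_fun (fun w => f i (X i w)).
  by apply: (bounded_fun_itv (a := 0)) => w; rewrite f_ge0; exact: f_le.
pose S w := \prod_(i < n) f i (X i w).
have bS : bounded_fun S.
  apply: (@bounded_fun_itv _ _ _ 0 (\prod_i expR (s * (a i + B i - mu i)))) => w.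
  by rewrite prodr_ge0//= ler_prod// => i _; rewrite f_ge0 f_le.
have mgf_le i : upper_expectation K (fun w => f i (X i w)) <=
    expR (s ^+ 2 * B i ^+ 2 / 8).
  apply: upper_expectation_le => // E KE.
  apply: le_trans (expectation_hoeffding E (X_itv i) s_ge0).
  apply: expectation_le => //.
    apply: (@bounded_fun_itv _ _ _ 0 (expR (s * (a i + B i - E (X i))))) => w.
    by rewrite expR_ge0 ler_expR ler_wpM2l// lerB//; have /andP[] := X_itv i w.
  move=> w; rewrite fX ler_expR ler_wpM2l// lerB//.
  exact: le_upper_expectation (bounded_fun_itv (X_itv i)) KE.
have US : upper_expectation K S <= expR (s ^+ 2 * gamma / 8).
  apply: (le_trans (X_prod f _ _)) => //.
    move=> i; apply: (bounded_fun_itv (a := 0)) => x.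
    by rewrite f_ge0; exact: f_le.
  rewrite /gamma mulr_sumr mulr_suml expR_sum; apply: ler_prod => i _.
  rewrite mgf_le andbT.
  have [E KE] := K_nonempty.
  apply: le_trans (le_upper_expectation (bfX i) KE).
  rewrite -(expectation_cst E 0); apply: expectation_le => //.
  by apply: (@bounded_fun_itv _ _ _ 0 0) => w; rewrite lexx.
have markov w : \1_A w <= expR (- (s * eps)) * S w.
  have -> : S w = expR (s * \sum_(i < n) (X i w - mu i)).
    by rewrite mulr_sumr expR_sum; apply: eq_bigr => i _.
  rewrite -expRD indicE; case: (boolP (w \in A)) => [|_]; last exact: expR_ge0.
  rewrite inE => /= wA; rewrite -[leLHS]expR0 ler_expR addrC subr_ge0.
  exact: ler_wpM2l.
apply: upper_expectation_le => // E KE.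
apply: (@le_trans _ _ (E (fun w => expR (- (s * eps)) * S w))).
  apply: expectation_le => //.
    apply: (@bounded_fun_itv _ _ _ 0 1) => w.
    by rewrite indicE; case: (w \in A) => /=; rewrite ?lexx ?ler01.
  have [M SM] := bounded_fun_norm bS.
  pose N := expR (- (s * eps)) * M.
  apply: (@bounded_fun_itv _ _ _ (- N) N) => w.
  by rewrite -ler_norml normrM ger0_norm ?expR_ge0// ler_wpM2l ?expR_ge0.
rewrite expectationZ//.
have -> : - 2 * eps ^+ 2 / gamma = - (s * eps) + s ^+ 2 * gamma / 8.
  by rewrite /s; field; lra.
rewrite expRD ler_wpM2l ?expR_ge0// (le_trans _ US)//.
exact: le_upper_expectation.
Qed.

Theorem theorem1 (R : realType) (Omega : Type)
    (K : set (expectation_functional R Omega)) (K_nonempty : K !=set0)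
    (n : nat) (X : 'I_n -> Omega -> R) (B : 'I_n -> R)
    (X_bounded : forall i, bounded_fun (X i))
    (X_range : forall i, sup (range (X i)) - inf (range (X i)) <= B i)
    (gamma : R) (gammaE : gamma = \sum_(i < n) B i ^+ 2)
    (gamma_gt0 : 0 < gamma)
    (X_prod : forall f : 'I_n -> R -> R,
      (forall i, bounded_fun (f i)) ->
      (forall i x, 0 <= f i x) ->
      upper_expectation K (fun w => \prod_(i < n) f i (X i w))
        <= \prod_(i < n) upper_expectation K (fun w => f i (X i w)))
    (eps : R) (eps_gt0 : 0 < eps) :
  upper_probability K
    [set w | \sum_(i < n) (X i w - upper_expectation K (X i)) >= eps]
    <= expR (- 2 * eps ^+ 2 / gamma)
  /\
  upper_probability K
    [set w | \sum_(i < n) (X i w - lower_expectation K (X i)) <= - eps]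
    <= expR (- 2 * eps ^+ 2 / gamma).
Proof.
pose a i := inf (range (X i)).
have X_itv i w : a i <= X i w <= a i + B i.
  have Xw : range (X i) (X i w) by exists w.
  apply/andP; split.
    by apply: ge_inf => //; exact: bounded_fun_has_lbound.
  have : X i w <= sup (range (X i)).
    by apply: ub_le_sup => //; exact: bounded_fun_has_ubound.
  by have := X_range i; rewrite /a; lra.
rewrite gammaE in gamma_gt0 *; split.
  exact: hoeffding_upper_tail X_itv _ _ _ _.
(* The lower tail of [X] is the upper tail of [Y]. *)
pose Y i w := - X i w.
have Y_itv i w : - (a i + B i) <= Y i w <= - (a i + B i) + B i.
  by rewrite /Y; have := X_itv i w; lra.
have Y_prod (f : 'I_n -> R -> R) : (forall i, bounded_fun (f i)) ->
    (forall i x, 0 <= f i x) ->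
    upper_expectation K (fun w => \prod_(i < n) f i (Y i w))
      <= \prod_(i < n) upper_expectation K (fun w => f i (Y i w)).
  move=> bf f0; apply: (X_prod (fun i x => f i (- x))) => // i.
  have [M fM] := bounded_fun_norm (bf i).
  by apply: (@bounded_fun_itv _ _ _ (- M) M) => x; rewrite -ler_norml.
have := hoeffding_upper_tail K_nonempty Y_itv gamma_gt0 Y_prod eps_gt0.
congr (upper_probability K _ <= _); apply/seteqP.
have SY w : \sum_(i < n) (Y i w - upper_expectation K (Y i)) =
    - \sum_(i < n) (X i w - lower_expectation K (X i)).
  rewrite -sumrN; apply: eq_bigr => i _.
  by rewrite upper_expectationN// opprB opprK addrC.
by split => w /=; rewrite SY lerNr.
Qed.
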